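(* Let $p=p(n)\in(0,1]$ satisfy $np\to\infty$ as $n\to\infty$. Then \[ \max_{\bar X}\mathbb E[\lambda_{\mathrm u}(X)]=O\Bigl((1-p)\sqrt{n/p}\Bigr)\qquad(n\to\infty), \] where the maximum is over all permutations $\bar X$ of $[n]=\{1,\dots,n\}$; that is, there is a constant $C$ such that for all sufficiently large $n$ and every permutation $\bar X$ of $[n]$, $\mathbb E[\lambda_{\mathrm u}(X)]\le C(1-p)\sqrt{n/p}$.
   Context: Random model: let $\bar X=(\bar x_1,\dots,\bar x_n)$ be a permutation of $[n]$. Each element (position) of $\bar X$ is independently marked with probability $p$ and left unmarked with probability $1-p$. Then the marked elements are permuted uniformly at random among the positions of the marked elements, while unmarked elements stay in their positions; the result is the random permutation $X=(x_1,\dots,x_n)$. An entry $x_k$ is a record (left-to-right maximum) of $X$ if $x_k>x_i$ for all $i<k$. Let $\lambda(X)$ be the number of records of $X$, and write $\lambda(X)=\lambda_{\mathrm u}(X)+\lambda_{\mathrm m}(X)$, where $\lambda_{\mathrm u}(X)$ (resp. $\lambda_{\mathrm m}(X)$) is the number of records of $X$ that are unmarked (resp. marked) elements of $\bar X$. *)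

(* Defs.v *)
From HB Require Import structures.
From mathcomp Require Import all_boot all_order all_algebra all_fingroup.
From mathcomp Require Import all_classical all_reals all_analysis.

Set Implicit Arguments.
Unset Strict Implicit.
Unset Printing Implicit Defensive.

Import Order.TTheory GRing.Theory Num.Theory.

Local Open Scope ring_scope.

(* Positions and values both range over 'I_n = {0, ..., n-1} instead of
   {1, ..., n}. An outcome of the random experiment is a pair w = (M, s): M is
   the set of marked positions of Xbar and s is the shuffle of the positions,
   which has to fix every position outside M. *)
Definition outcome (n : nat) : Type := ({set 'I_n} * 'S_n)%type.

Definition marking_prob (R : realType) (n : nat) (p : R) (M : {set 'I_n}) : R :=
  \prod_(i : 'I_n) (if i \in M then p else 1 - p).

(* perm.Sym M is the set of the permutations of the positions that fix every
   position outside M. *)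
Definition shuffle_prob (R : realType) (n : nat) (M : {set 'I_n}) (s : 'S_n) : R :=
  if s \in perm.Sym M then (#|perm.Sym M|%:R)^-1 else 0.

Definition outcome_prob (R : realType) (n : nat) (p : R) (w : outcome n) : R :=
  marking_prob p w.1 * shuffle_prob R w.1 w.2.

Definition expectation_smoothed (R : realType) (n : nat) (p : R)
    (Y : outcome n -> R) : R :=
  \sum_(w : {set 'I_n} * 'S_n) outcome_prob p w * Y w.

(* Products of permutations apply the left factor first, hence
   smoothed Xbar w i = Xbar (w.2 i). *)
Definition smoothed (n : nat) (Xbar : 'S_n) (w : outcome n) : 'S_n :=
  (w.2 * Xbar)%g.

Definition is_record (n : nat) (X : 'S_n) (k : 'I_n) : bool :=
  [forall i : 'I_n, (i < k)%N ==> (X i < X k)%N].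

(* Marked elements only move among marked positions, so the entry at position k
   of the smoothed permutation is an unmarked element iff k is unmarked. *)
Definition lambda_u (n : nat) (Xbar : 'S_n) (w : outcome n) : nat :=
  #|[set k : 'I_n | (k \notin w.1) && is_record (smoothed Xbar w) k]|.

(* Main.v *)
Require Import Defs.
From HB Require Import structures.
From mathcomp Require Import all_boot all_order all_algebra all_fingroup.
From mathcomp Require Import all_classical all_reals all_analysis.
From mathcomp Require Import zify ring lra.
Import Order.TTheory GRing.Theory Num.Theory.
Import numFieldNormedType.Exports.
Local Open Scope ring_scope.

(* Fix a position k and a marking M that leaves k unmarked, and let l (resp. h)
   be the number of marked positions before k (resp. of marked entries larger
   than the entry of k). If k is a record, the shuffle sends none of the h large
   entries to the l early positions. A switching argument bounds the probability
   of this by |M| / (|M| + h l), hence by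
   3 (|M| + 1) (1 / ((h+1)(h+2)) + 1 / ((l+1)(l+2))). The expectation of each
   term over M is computed by exchanging a marked and an unmarked element, so
   that k is an unmarked record with probability at most
   (1 - p) min(1, (3n/p) (1/x^2 + 1/y^2)), where x is the rank of the position k
   and y the rank from above of its entry. Both x and y run through 1, ..., n, and
   sum_x min(1, T^2/x^2) <= 4T with T = 2 sqrt(n/p) gives the bound with the
   constant 16, for every n > 0. *)

(* Switching: if s sends L outside H, swapping its values at i in L and at the
   preimage j of y in H gives a permutation that sends exactly one element of L
   into H, from which i and y, and then s from j, can be read off. *)
Lemma card_perm_avoid (T : finType) (M L H : {set T}) :
    L \subset M -> H \subset M ->
  (#|[set s in perm.Sym M | [forall i in L, s i \notin H]]| *
     (#|H| * #|L| + #|M|) <= #|M| * #|perm.Sym M|)%N.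
Proof.
move=> /fintype.subsetP LM /fintype.subsetP HM.
set A := [set s in _ | _].
pose f (t : {perm T} * (T * T)) :=
  let j := (t.1^-1)%g t.2.2 in ((tperm t.2.1 j * t.1)%g, j).
have fE (s : {perm T}) i y (j := (s^-1)%g y) : s \in A -> i \in L -> y \in H ->
    [/\ j \in M, j \notin L, (tperm i j * s)%g i = y &
      forall x, x \in L -> x != i -> (tperm i j * s)%g x \notin H].
  rewrite 2!inE => /andP[sM /forall_inP sA] iL yH.
  have sj : s j = y by rewrite permKV.
  have jL : j \notin L by apply: contraTN yH => /sA; rewrite sj.
  split=> //.
  - by rewrite -(perm_closed _ sM) sj HM.
  - by rewrite permM tpermL.
  - move=> x xL xi; rewrite permM tpermD ?sA //; first by rewrite eq_sym.
    by apply: contraNneq jL => ->.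
have finj : {in finset.setX A (finset.setX L H) &, injective f}.
  move=> [s [i y]] [s' [i' y']] /=; rewrite !finset.in_setX /=.
  move=> /and3P[sA iL yH] /and3P[sA' iL' yH'] [ets ej].
  have [_ _ e1 a1] := fE _ _ _ sA iL yH.
  have [_ _ e2 a2] := fE _ _ _ sA' iL' yH'.
  have ei : i = i'.
    by apply/eqP/negPn/negP => /a2 -/(_ iL); rewrite -ets e1 yH.
  subst i'; have ey : y = y' by rewrite -e1 -e2 ets.
  by subst y'; rewrite ej in ets; move/mulgI : ets => ->.
have sub : f @: finset.setX A (finset.setX L H) \subset
    finset.setX (perm.Sym M :\: A) M.
  apply/fintype.subsetP => t /imsetP[[s [i y]]].
  rewrite finset.in_setX /= finset.in_setX /= => /and3P[sA iL yH] ->{t}.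
  have [jM _ e _] := fE _ _ _ sA iL yH.
  rewrite finset.in_setX /= jM andbT inE; apply/andP; split.
    apply/negP; rewrite inE => /andP[_ /forall_inP /(_ _ iL)].
    by rewrite e yH.
  move: sA; rewrite !inE => /andP[sM _]; apply: perm_onM => //.
  apply/fintype.subsetP => x; rewrite inE; case: tpermP => [->|->|]; rewrite ?eqxx //.
  by move=> _; rewrite LM.
(* Injectivity of [f] gives |A| |L| |H| <= (|Sym M| - |A|) |M|. Moving |A| |M| to the left is the
   claim. *)
have := subset_leq_card sub; rewrite card_in_imset // !cardsX cardsD.
have -> : perm.Sym M :&: A = A.
  by apply/finset.setIidPr/fintype.subsetP => s; rewrite inE => /andP[].
have : (#|A| <= #|perm.Sym M|)%N.
  by apply/subset_leq_card/fintype.subsetP => s; rewrite inE => /andP[].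
set a := #|A|; set S := #|perm.Sym M| => aS; rewrite mulnBl mulnDr.
have := leq_mul aS (leqnn #|M|).
rewrite [(#|H| * _)%N]mulnC [(#|M| * S)%N]mulnC.
set x := (_ * (#|L| * _))%N; set y := (a * #|M|)%N; set z := (S * _)%N; lia.
Qed.

(** * Sums over the markings that leave k unmarked *)

Section Marking.
Variables (R : realType) (n : nat) (p : R).
Implicit Types (M B : {set 'I_n}) (i k : 'I_n).

Lemma marking_prob_setD1 M i : i \in M ->
  p * marking_prob p (M :\ i) = (1 - p) * marking_prob p M.
Proof.
move=> iM; rewrite /marking_prob (bigD1 i) //= [in RHS](bigD1 i) //=.
rewrite iM !inE eqxx /= mulrA [in RHS]mulrA [p * _]mulrC; congr (_ * _).
by apply: eq_bigr => j ji; rewrite !inE ji.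
Qed.

Lemma sum_marking_prob_notin k :
  \sum_(M : {set 'I_n} | k \notin M) marking_prob p M = 1 - p.
Proof.
(* Expanding the product of [F i + (1 - p)] gives a sum over sets M; [F k = 0] kills those
   containing k. *)
pose F i := if i == k then 0 else p.
have <- : \prod_i (F i + (1 - p)) = 1 - p.
  rewrite (bigD1 k) //= /F eqxx add0r big1 ?mulr1 // => i /negbTE ->.
  by rewrite addrC subrK.
rewrite bigA_distr [in RHS](bigID (fun M : {set 'I_n} => k \notin M)) /=.
rewrite [X in _ + X]big1 ?addr0 => [|M]; last first.
  by rewrite negbK => kM; rewrite (bigD1 k) //= kM /F eqxx mul0r.
apply: eq_bigr => M kM; apply: eq_bigr => i _; case: ifP => // iM.
by rewrite /F; case: eqP iM kM => // -> ->.
Qed.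

(* p * w(M) = (1 - p) * w(i |: M) turns a sum over the unmarked elements i of B
   into a sum over the marked ones. *)
Lemma marking_size_bias k B (u : nat -> nat -> R) : k \notin B ->
  p * \sum_(M : {set 'I_n} | k \notin M) marking_prob p M *
        ((#|B|%:R - #|M :&: B|%:R) * u #|M|.+1 #|M :&: B|.+1) =
  (1 - p) * \sum_(M : {set 'I_n} | k \notin M) marking_prob p M *
        (#|M :&: B|%:R * u #|M| #|M :&: B|).
Proof.
move=> kB; rewrite !mulr_sumr.
transitivity (\sum_(M : {set 'I_n} | k \notin M) \sum_(i in B :\: M)
    p * marking_prob p M * u #|i |: M| #|(i |: M) :&: B|).
  apply: eq_bigr => M _.
  under eq_bigr => i.
    rewrite inE => /andP[iM iB].
    rewrite finset.setIUl (finset.setIidPl _) ?finset.sub1set // !cardsU1 inE.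
    rewrite iB andbT iM.
    over.
  rewrite sumr_const cardsD [B :&: M]finset.setIC -[RHS]mulr_natl.
  rewrite natrB ?subset_leq_card ?finset.subsetIr //.
  rewrite !add1n; ring.
transitivity (\sum_(M : {set 'I_n} | k \notin M) \sum_(i in M :&: B)
    (1 - p) * marking_prob p M * u #|M| #|M :&: B|); last first.
  by apply: eq_bigr => M _; rewrite sumr_const -[LHS]mulr_natl; ring.
rewrite (exchange_big_dep (mem B)) /=; last first.
  by move=> M i _; rewrite inE => /andP[].
rewrite [RHS](exchange_big_dep (mem B)) /=; last first.
  by move=> M i _; rewrite inE => /andP[].
apply: eq_bigr => i iB.
have ik : i != k by apply: contraNneq kB => <-.
(* For fixed i in B, removing i maps the markings containing i bijectively onto those avoiding it,
   and leaves k unmarked. *)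
rewrite (reindex_onto (fun M => M :\ i) (fun M => i |: M)) /=; last first.
  by move=> M /andP[_]; rewrite inE => /andP[iM _]; rewrite finset.setU1K.
apply: eq_big => [M|M /andP[/andP[_ _] /eqP eM]]; last first.
  have iM : i \in M by rewrite -eM setU11.
  by rewrite finset.setD1K // marking_prob_setD1.
rewrite !inE iB eqxx /= !andbT eq_sym (negbTE ik) eq_sym /=.
have [iM|iM] := boolP (i \in M); first by rewrite finset.setD1K // eqxx.
rewrite andbF [X in _ && X](_ : _ = false) ?andbF //.
by apply: contraNF iM => /eqP ->; rewrite setU11.
Qed.

(** Size bias with [u = 1] and B the complement of k gives p (1 - p) (n - 1) for the sum of |M|; the
    extra p turns n - 1 into n. *)
Lemma sum_marking_card k :
  \sum_(M : {set 'I_n} | k \notin M) marking_prob p M * (#|M|%:R + p) =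
  (1 - p) * (n%:R * p).
Proof.
have kB : k \notin [set~ k] by rewrite !inE eqxx.
have n0 : (0 < n)%N := leq_ltn_trans (leq0n k) (ltn_ord k).
have := marking_size_bias _ _ (fun _ _ => 1) kB.
have cB : #|[set~ k]|%:R = n%:R - 1 :> R.
  by rewrite cardsC1 card_ord -subn1 natrB.
have MB (M : {set 'I_n}) : k \notin M -> M \subset [set~ k].
  by move=> kM; apply/fintype.subsetP => i iM; rewrite !inE; apply: contraNneq kM => <-.
under eq_bigr => M kM.
  rewrite (finset.setIidPl (MB M kM)).
  rewrite cB mulr1 mulrBr; over.
under [in RHS]eq_bigr => M kM.
  rewrite (finset.setIidPl (MB M kM)).
  rewrite mulr1; over.
rewrite big_split/= sumrN -mulr_suml sum_marking_prob_notin => e.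
under eq_bigr do rewrite mulrDr.
rewrite big_split /= -mulr_suml sum_marking_prob_notin.
move: e; set S := \sum_(i | _) _; move=> e.
nra.
Qed.

Lemma marking_prob_ge0 M : 0 < p <= 1 -> 0 <= marking_prob p M.
Proof.
by move=> /andP[p0 p1]; apply: prodr_ge0 => i _; case: ifP => _; lra.
Qed.

(** With h = |M :&: B|, write (|B| + 1) / (h + 1) = (|B| - h) / (h + 1) + 1 and apply size bias with
    [u m h = m / h] to the first part. *)
Lemma sum_marking_inv_le k B : 0 < p <= 1 -> k \notin B ->
  p * #|B|.+1%:R *
    \sum_(M : {set 'I_n} | k \notin M)
      marking_prob p M * (#|M|.+1%:R / #|M :&: B|.+1%:R)
  <= (1 - p) * (n%:R * p).
Proof.
move=> p01 kB; have /andP[p0 p1] := p01.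
have := marking_size_bias _ _ (fun m h => m%:R / h%:R) kB.
set S1 := \sum_(M | _) _; set S2 := \sum_(M | _) _; set S := \sum_(M | _) _ => e.
rewrite -(sum_marking_card k).
have -> : \sum_(M : {set 'I_n} | k \notin M) marking_prob p M * (#|M|%:R + p) =
  (1 - p) * (\sum_(M : {set 'I_n} | k \notin M) marking_prob p M * #|M|%:R) +
    p * \sum_(M : {set 'I_n} | k \notin M) marking_prob p M * #|M|.+1%:R.
  rewrite !mulr_sumr -big_split /=; apply: eq_bigr => M _.
  by rewrite -natr1; ring.
have -> : p * #|B|.+1%:R * S = p * S1 +
    p * \sum_(M : {set 'I_n} | k \notin M) marking_prob p M * #|M|.+1%:R.
  rewrite -mulrA -mulrDr; congr (_ * _).
  rewrite mulr_sumr -big_split /=; apply: eq_bigr => M _.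
  rewrite -natr1 -[#|_ :&: _|.+1%:R]natr1; field.
  by rewrite natr1 pnatr_eq0.
rewrite lerD2r e ler_wpM2l//; first lra.
apply: ler_sum => M _; rewrite ler_wpM2l ?marking_prob_ge0 //.
(* The product h (m / h) is m, except that it is 0 for h = 0; hence only an inequality. *)
have [->|h0] := posnP #|M :&: B|; first by rewrite mul0r.
by rewrite mulrC divfK // pnatr_eq0 -lt0n.
Qed.

Lemma sum_marking_inv2_le k B : 0 < p <= 1 -> k \notin B ->
   \sum_(M : {set 'I_n} | k \notin M) marking_prob p M *
      (#|M|.+1%:R / (#|M :&: B|.+1%:R * #|M :&: B|.+2%:R))
  <= (1 - p) * (n%:R / (p * #|B|.+1%:R ^+ 2)).
Proof.
move=> p01 kB; have /andP[p0 p1] := p01.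
have := marking_size_bias _ _ (fun m h => m%:R / (h%:R * h.+1%:R)) kB.
set S1 := \sum_(M | _) _; set S2 := \sum_(M | _) _; set S := \sum_(M | _) _ => e.
have := sum_marking_inv_le _ _ p01 kB.
set S3 := \sum_(M | _) _ => h1.
(* Same scheme one degree higher: (|B| + 2) / ((h + 1) (h + 2)) = (|B| - h) / ((h + 1) (h + 2)) + 1
   / (h + 1). *)
have h2 : p * #|B|.+2%:R * S = p * S1 + p * S3.
  rewrite -mulrA -mulrDr; congr (_ * _).
  rewrite mulr_sumr -big_split /=; apply: eq_bigr => M _.
  rewrite -!natr1; field.
  by rewrite !natr1 !pnatr_eq0.
have h3 : S2 <= S3.
  apply: ler_sum => M _; rewrite ler_wpM2l ?marking_prob_ge0 //.
  have [->|h0] := posnP #|M :&: B|; first by rewrite mul0r divr_ge0.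
  rewrite mulrA -mulf_div divff ?pnatr_eq0 -?lt0n // mul1r.
  by rewrite ler_wpM2r // ler_nat.
have S0 : 0 <= S.
  apply: sumr_ge0 => M _; rewrite mulr_ge0 ?marking_prob_ge0 //.
have b0 : 0 < #|B|.+1%:R :> R by rewrite ltr0n.
(* Size bias and [S2 <= S3] give p (|B| + 2) S <= S3; |B| + 2 is weakened to |B| + 1 to match the
   factor in [h1]. *)
have h4 : p * #|B|.+1%:R * S <= S3.
  have h5 : (1 - p) * S2 <= (1 - p) * S3 by rewrite ler_wpM2l //; lra.
  have h6 : 0 <= p * S by rewrite mulr_ge0 //; lra.
  move: h2; rewrite e -natr1; set b := #|B|.+1%:R => h2; lra.
rewrite mulrA ler_pdivlMr; last by rewrite mulr_gt0 ?exprn_gt0 //; lra.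
have h5 : p * #|B|.+1%:R * (p * #|B|.+1%:R * S) <= p * ((1 - p) * n%:R).
  apply: le_trans (ler_wpM2l _ h4) _; first by rewrite mulr_ge0 //; lra.
  by rewrite (le_trans h1) //; lra.
rewrite -(ler_pM2l (_ : 0 < p)); last by lra.
by apply: le_trans h5; rewrite le_eqVlt; apply/orP; left; apply/eqP; ring.
Qed.

End Marking.

(** * Ranks and a truncated sum of inverse squares *)

Lemma card_ord_lt n m : (m <= n)%N -> #|[set i : 'I_n | (i < m)%N]| = m.
Proof.
by move=> mn; rewrite -sum1dep_card (big_ord_narrow mn) sum1_card card_ord.
Qed.

Lemma card_perm_gt n (X : 'S_n) (k : 'I_n) :
  #|[set i | (X k < X i)%N]| = rev_ord (X k).
Proof.
have revX_inj : injective (fun i => rev_ord (X i)).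
  by move=> i j /rev_ord_inj/perm_inj.
rewrite -[RHS](@card_ord_lt n) ?(ltnW (ltn_ord _)) // -!sum1dep_card.
rewrite [RHS](reindex_inj revX_inj) /=; apply: eq_bigl => i.
by have := ltn_ord (X i); have := ltn_ord (X k); lia.
Qed.

(** Each term is at most 4 T^2 (1 / (T + i) - 1 / (T + i + 1)), and these differences telescope to
    at most 4 T^2 / T. *)
Lemma sum_min_inv_sqr (R : realType) (T : R) (n : nat) : 0 < T ->
  \sum_(i < n) Num.min 1 (T ^+ 2 / i.+1%:R ^+ 2) <= 4 * T.
Proof.
move=> T0.
have step (i : 'I_n) : Num.min 1 (T ^+ 2 / i.+1%:R ^+ 2) <=
    - (4 * T ^+ 2 / (T + i.+1%:R)) - - (4 * T ^+ 2 / (T + i%:R)).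
  have i0 : 0 <= i%:R :> R by [].
  rewrite -natr1; set x := i%:R in i0 *.
  have -> : - (4 * T ^+ 2 / (T + (x + 1))) - - (4 * T ^+ 2 / (T + x)) =
      4 * T ^+ 2 / ((T + x) * (T + (x + 1))).
    by field; apply/andP; split; apply: lt0r_neq0; lra.
  have d0 : 0 < (T + x) * (T + (x + 1)) by apply: mulr_gt0; lra.
  (* Both factors of the denominator are at most twice the larger of T and x + 1. *)
  have [Tx|xT] := leP T (x + 1); rewrite ge_min; apply/orP; [right|left].
    rewrite ler_pdivrMr ?exprn_gt0 //; last lra.
    rewrite mulrAC ler_pdivlMr // [4 * _]mulrC -[leRHS]mulrA.
    by rewrite ler_wpM2l ?sqr_ge0 //; nra.
  by rewrite ler_pdivlMr // mul1r; nra.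
apply: (le_trans (ler_sum _ (fun i _ => step i))).
rewrite -(big_mkord xpredT (fun i =>
  - (4 * T ^+ 2 / (T + i.+1%:R)) - - (4 * T ^+ 2 / (T + i%:R)))) /=.
rewrite telescope_sumr // addr0 opprK.
have -> : 4 * T ^+ 2 / T = 4 * T by field; exact: lt0r_neq0.
rewrite gerDr oppr_le0 divr_ge0 ?mulr_ge0 ?sqr_ge0 ?addr_ge0 //; exact: ltW.
Qed.

(** * Probability that an unmarked position is a record *)

Section Record.
Variables (R : realType) (n : nat).
Implicit Types (X : 'S_n) (M : {set 'I_n}) (k : 'I_n).

Definition record_prob (X : 'S_n) (k : 'I_n) (M : {set 'I_n}) : R :=
  \sum_(s : 'S_n) shuffle_prob R M s * (is_record (smoothed X (M, s)) k)%:R.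

(** An unmarked k keeps its entry [X k], so if k is a record, no marked position before k receives a
    larger entry. *)
Lemma record_prob_le_card X k M (L := [set i : 'I_n | (i < k)%N])
    (H := [set i | (X k < X i)%N]) : k \notin M ->
  record_prob X k M <=
  #|[set s in perm.Sym M | [forall i in M :&: L, s i \notin M :&: H]]|%:R /
    #|perm.Sym M|%:R.
Proof.
move=> kM; set A := [set s in _ | _].
rewrite -[X in _ <= X / _]sumr_const mulr_suml [leRHS]big_mkcond /=.
apply: ler_sum => s _; rewrite /shuffle_prob.
have [sM|sM] := ifPn; last first.
  by rewrite mul0r; case: ifP => // _; rewrite divr_ge0.
have [rec|_] := boolP (is_record _ k); last first.
  by rewrite mulr0; case: ifP => // _; rewrite divr_ge0.
suff -> : s \in A by rewrite mulr1 mul1r.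
rewrite inE sM /=; apply/forall_inP => i; rewrite !inE => /andP[_ ik].
move/forallP/(_ i)/implyP/(_ ik): rec.
rewrite /smoothed /= !permM (out_perm _ kM); last by move: sM; rewrite inE.
by move=> lt; rewrite [(X k < _)%N]ltnNge (ltnW lt) andbF.
Qed.

Lemma record_prob_ge0 X k M : 0 <= record_prob X k M.
Proof.
apply: sumr_ge0 => s _; rewrite mulr_ge0 // /shuffle_prob.
by case: ifP; rewrite ?invr_ge0.
Qed.

Lemma record_prob_le1 X k M : k \notin M -> record_prob X k M <= 1.
Proof.
move=> kM; apply: (le_trans (record_prob_le_card X _ _ kM)).
rewrite ler_pdivrMr ?mul1r; last first.
  by rewrite ltr0n card_Sym fact_gt0.
rewrite ler_nat subset_leq_card //.
by apply/fintype.subsetP => s; rewrite inE => /andP[].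
Qed.

Lemma record_prob_le X k M (l := #|M :&: [set i : 'I_n | (i < k)%N]|)
    (h := #|M :&: [set i | (X k < X i)%N]|) : k \notin M ->
  record_prob X k M <=
  3 * (#|M|.+1%:R / (h.+1%:R * h.+2%:R) + #|M|.+1%:R / (l.+1%:R * l.+2%:R)).
Proof.
move=> kM.
have S0 : 0 < #|perm.Sym M|%:R :> R by rewrite ltr0n card_Sym fact_gt0.
set L := M :&: [set i : 'I_n | (i < k)%N]; set H := M :&: [set i | (X k < X i)%N].
have := record_prob_le_card X _ _ kM; rewrite ler_pdivlMr // -/L -/H.
set A := [set s in _ | _] => rA.
(* In (l + 1) (h + 1) = l h + l + h + 1 the switching bound handles l h; the bounds l, h <= |M| and
   |A| <= |Sym M| absorb the rest. *)
have cA : (#|A| * (l.+1 * h.+1) <= 3 * #|M|.+1 * #|perm.Sym M|)%N.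
  have : (#|A| <= #|perm.Sym M|)%N.
    by apply/subset_leq_card/fintype.subsetP => s; rewrite inE => /andP[].
  have LM : L \subset M by exact: finset.subsetIl.
  have HM : H \subset M by exact: finset.subsetIl.
  have := card_perm_avoid _ _ _ _ LM HM.
  have := subset_leq_card LM; have := subset_leq_card HM.
  rewrite -/A -[#|L|]/l -[#|H|]/h.
  move: (#|A|) (#|M|) (#|perm.Sym M|) l h => a m S x y ym xm.
  rewrite mulnDr => aS1 aS2.
  have := leq_mul (leqnn a) xm; have := leq_mul (leqnn a) ym.
  nia.
have {rA cA} : record_prob X k M <= 3 * (#|M|.+1%:R / (l.+1%:R * h.+1%:R)).
  rewrite mulrA ler_pdivlMr -?natrM ?ltr0n ?muln_gt0 //.
  rewrite -(ler_pM2r S0) mulrAC; apply: (le_trans (ler_wpM2r _ rA)) => //.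
  by rewrite -!natrM ler_nat.
move=> /le_trans; apply; rewrite ler_wpM2l // -mulrDr ler_wpM2l //.
rewrite -!natr1.
have : 0 <= h%:R :> R by []. have : 0 <= l%:R :> R by [].
move: (h%:R : R) (l%:R : R) => x y y0 x0.
(* This decouples h from l, so that each term can be averaged over M separately; the surplus is
   nonnegative because x^2 - x y + y^2 is. *)
have -> : ((x + 1) * (x + 1 + 1))^-1 + ((y + 1) * (y + 1 + 1))^-1 =
    ((y + 1) * (x + 1))^-1 + (x ^+ 2 + y ^+ 2 - x * y + x + y) /
      ((x + 1) * (x + 1 + 1) * ((y + 1) * (y + 1 + 1))).
  by field; do 3?[apply/andP; split]; apply: lt0r_neq0; lra.
rewrite lerDl divr_ge0 //; first nra.
by rewrite !mulr_ge0 //; lra.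
Qed.

Variables (p : R).

(** A joint probability, not conditioned on k being unmarked; this is the source of the factor 1 -
    p. *)
Definition unmarked_record_prob X k : R :=
  \sum_(M : {set 'I_n} | k \notin M) marking_prob p M * record_prob X k M.

Lemma unmarked_record_prob_le1 X k : 0 < p <= 1 ->
  unmarked_record_prob X k <= 1 - p.
Proof.
move=> p01; rewrite -(sum_marking_prob_notin _ _ _ k); apply: ler_sum => M kM.
by rewrite ler_piMr ?marking_prob_ge0 ?record_prob_le1.
Qed.

Lemma unmarked_record_prob_le X k : 0 < p <= 1 ->
  unmarked_record_prob X k <=
  (1 - p) * (3 * n%:R / p / k.+1%:R ^+ 2 +
             3 * n%:R / p / (rev_ord (X k)).+1%:R ^+ 2).
Proof.
move=> p01; have /andP[p0 p1] := p01.
set L := [set i : 'I_n | (i < k)%N]; set H := [set i | (X k < X i)%N].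
have kL : k \notin L by rewrite inE ltnn.
have kH : k \notin H by rewrite inE ltnn.
have bL := sum_marking_inv2_le _ _ _ _ _ p01 kL.
have bH := sum_marking_inv2_le _ _ _ _ _ p01 kH.
rewrite card_ord_lt ?(ltnW (ltn_ord k)) // in bL.
rewrite card_perm_gt in bH.
apply: le_trans (_ : 3 * (_ + _) <= _); last first.
  apply: le_trans (ler_wpM2l _ (lerD bL bH)) _ => //.
  rewrite le_eqVlt; apply/orP; left; apply/eqP.
  by field; rewrite !nat1r !pnatr_eq0 /= lt0r_neq0.
rewrite -big_split mulr_sumr; apply: ler_sum => M kM /=.
rewrite -mulrDr mulrCA ler_wpM2l ?marking_prob_ge0 // addrC.
exact: record_prob_le.
Qed.

Lemma unmarked_record_prob_le_min X k (T := 2 * Num.sqrt (n%:R / p)) :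
  0 < p <= 1 ->
  unmarked_record_prob X k <=
  (1 - p) * (Num.min 1 (T ^+ 2 / k.+1%:R ^+ 2) +
             Num.min 1 (T ^+ 2 / (rev_ord (X k)).+1%:R ^+ 2)).
Proof.
move=> p01; have /andP[p0 p1] := p01.
have T2 : T ^+ 2 = 4 * n%:R / p.
  by rewrite exprMn sqr_sqrtr ?divr_ge0 ?(ltW p0) //; field; exact: lt0r_neq0.
(* The factor 2 in [T] makes T^2 = 4 n / p dominate the 3 n / p of the averaged bound. *)
have mono (j : nat) : 3 * n%:R / p / j.+1%:R ^+ 2 <= T ^+ 2 / j.+1%:R ^+ 2.
  by rewrite T2 !ler_wpM2r ?invr_ge0 ?sqr_ge0 ?(ltW p0) // ler_nat.
have pos (j : nat) : 0 <= T ^+ 2 / j.+1%:R ^+ 2 by rewrite divr_ge0 ?sqr_ge0.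
set a := T ^+ 2 / _; set b := T ^+ 2 / _.
have a0 : 0 <= a := pos _. have b0 : 0 <= b := pos _.
have q0 : 0 <= 1 - p by lra.
(* If [a] or [b] reaches 1, one minimum equals 1 and the trivial bound 1 - p suffices. *)
have [a1|a1] := leP 1 a; last have [b1|b1] := leP 1 b.
- apply: le_trans (unmarked_record_prob_le1 X k p01) _.
  by rewrite ler_peMr // lerDl le_min b0 ler01.
- apply: le_trans (unmarked_record_prob_le1 X k p01) _.
  by rewrite ler_peMr // lerDr.
- apply: le_trans (unmarked_record_prob_le X k p01) _.
  by rewrite ler_wpM2l // lerD ?mono.
Qed.

(** Linearity of expectation over the record indicators of the unmarked positions. *)
Lemma expectation_lambda_u X :
  expectation_smoothed p (fun w => (lambda_u X w)%:R) =
  \sum_k unmarked_record_prob X k.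
Proof.
rewrite /expectation_smoothed.
transitivity (\sum_(w : {set 'I_n} * 'S_n) \sum_(k | k \notin w.1)
    outcome_prob p w * (is_record (smoothed X w) k)%:R).
  apply: eq_bigr => w _; rewrite -mulr_sumr; congr (_ * _).
  rewrite /lambda_u -sum1dep_card natr_sum big_mkcondr /=.
  by apply: eq_bigr => k _; case: ifP.
rewrite (exchange_big_dep xpredT) //=; apply: eq_bigr => k _.
rewrite /unmarked_record_prob.
under [RHS]eq_bigr do rewrite mulr_sumr.
rewrite pair_big_dep /=; apply: eq_big => [w|w _]; first by rewrite andbT.
by case: w => M s; rewrite mulrA.
Qed.

End Record.

(** * Summation over all positions *)

Local Open Scope classical_set_scope.

Theorem theorem1 (R : realType) (p : nat -> R)
    (p_range : forall n : nat, (0 < n)%N -> 0 < p n <= 1)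
    (np_infty : (fun n : nat => n%:R * p n) @ \oo --> +oo) :
  exists C : R, \forall n \near \oo, forall Xbar : 'S_n,
    expectation_smoothed (p n) (fun w => (lambda_u Xbar w)%:R)
      <= C * ((1 - p n) * Num.sqrt (n%:R / p n)).
Proof.
exists 16; near=> n => X.
have n0 : (0 < n)%N by near: n; exact: nbhs_infty_gt.
have p01 := p_range _ n0; have /andP[p0 p1] := p01.
rewrite expectation_lambda_u.
apply: le_trans (ler_sum _ (fun k _ => unmarked_record_prob_le_min _ _ _ X k p01)) _.
set T := 2 * _.
have T0 : 0 < T by rewrite mulr_gt0 // sqrtr_gt0 divr_gt0 // ltr0n.
have revX_inj : injective (fun i => rev_ord (X i)).
  by move=> i j /rev_ord_inj/perm_inj.
rewrite -mulr_sumr big_split /=.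
(* Since [rev_ord (X k)] runs through every rank once, both sums are equal. *)
rewrite -[X in _ * (_ + X)](reindex_inj revX_inj (P := xpredT)
  (F := fun i : 'I_n => Num.min 1 (T ^+ 2 / i.+1%:R ^+ 2))) /=.
rewrite [leRHS]mulrCA ler_wpM2l ?subr_ge0 //.
(* Two sums of at most 4 T each, with T = 2 sqrt(n / p), give 16. *)
by have := sum_min_inv_sqr _ _ n T0; rewrite /T; lra.
Unshelve. all: by end_near.
Qed.
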